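(* Let $u$ be a positive integer. Every $D(u^2)$-triple of triangular numbers whose smallest element is $T_{4u-1}$ or $T_{4u}$ is irregular (that is, not regular). In particular, if $n\in\{4u-1,4u\}$, $U=2n+1$, and $(a_k)_{k\ge0}$ is defined by $a_0=0$, $a_1=n+4u$, $a_{k+2}=2Ua_{k+1}-a_k+2n$ for $k\ge0$, then for every $k\ge1$ the $D(u^2)$-triple $\{T_n,T_{a_k},T_{a_{k+1}}\}$ is irregular.
   Context: For a positive integer $m$, $T_m=m(m+1)/2$ denotes the $m$-th triangular number. For a positive integer $N$, a $D(N)$-triple is a set of three distinct positive integers such that the product of any two distinct elements, increased by $N$, is a perfect square. A $D(N)$-triple $\{T_a,T_b,T_c\}$ with $1\le a<b<c$ is called regular if $T_c=T_a+T_b+2\sqrt{T_aT_b+N}$, equivalently $(T_c-T_a-T_b)^2=4(T_aT_b+N)$; otherwise it is irregular. *)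

(* Defs.v *)
From mathcomp Require Import all_boot all_order all_algebra.
From mathcomp Require Import finmap.
From mathcomp Require Import zify.

Set Implicit Arguments.
Unset Strict Implicit.
Unset Printing Implicit Defensive.

Local Open Scope nat_scope.

Definition triangular (m : nat) : nat := (m * m.+1) %/ 2.

Definition is_triangular (x : nat) : Prop :=
  exists2 m : nat, 0 < m & x = triangular m.

Definition perfect_square (x : nat) : Prop := exists r : nat, x = r ^ 2.

Definition D_triple (N : nat) (S : {fset nat}) : Prop :=
  [/\ #|` S|%fset = 3,
      forall x, x \in S -> 0 < x
    & forall x y, x \in S -> y \in S -> x != y -> perfect_square (x * y + N)].

Definition smallest_element (x : nat) (S : {fset nat}) : Prop :=
  x \in S /\ forall y, y \in S -> x <= y.

(* Meant for D(N)-triples of triangular numbers. The indices a < b < c are then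
   determined by S; the equation is over int to avoid truncated subtraction. *)
Definition regular (N : nat) (S : {fset nat}) : Prop :=
  exists a b c : nat,
    [/\ 1 <= a, a < b, b < c,
        S = [fset triangular a; triangular b; triangular c]%fset
      & (((triangular c)%:Z - (triangular a)%:Z - (triangular b)%:Z) ^+ 2
         = 4%:Z * ((triangular a)%:Z * (triangular b)%:Z + N%:Z))%R].

Definition irregular (N : nat) (S : {fset nat}) : Prop := ~ regular N S.

(* The subtraction never truncates: see aseq_rec. *)
Fixpoint aseq (u n k : nat) : nat :=
  match k with
  | 0 => 0
  | k'.+1 =>
    match k' with
    | 0 => n + 4 * u
    | k''.+1 => 2 * (2 * n + 1) * aseq u n k' + 2 * n - aseq u n k''
    end
  end.

Lemma aseqSS (u n k : nat) :
  aseq u n k.+2 = 2 * (2 * n + 1) * aseq u n k.+1 + 2 * n - aseq u n k.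
Proof. by []. Qed.

Lemma leq_aseq (u n k : nat) : aseq u n k <= aseq u n k.+1.
Proof. by elim: k => // k IHk; rewrite aseqSS; nia. Qed.

Lemma aseq_rec (u n k : nat) :
  ((aseq u n k.+2)%:Z =
     2%:Z * (2 * n + 1)%N%:Z * (aseq u n k.+1)%:Z
     - (aseq u n k)%:Z + 2%:Z * n%:Z)%R.
Proof. by have := leq_aseq u n k; rewrite aseqSS; nia. Qed.

(* Main.v *)
Require Import Defs.
From mathcomp Require Import all_boot all_order all_algebra.
From mathcomp Require Import finmap.
From mathcomp Require Import zify.

(** Put W = T_c - T_a - T_b. Since T_(a+b) = T_a + T_b + ab and
    T_(a+b+1) = T_a + T_b + (a+1)(b+1), regularity, which reads
    W^2 = a(a+1)b(b+1) + 4N, places c strictly between a+b and a+b+1 as soon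
    as 0 < N and 4N < (a+1)(b+1)(a+b+1); for N = u^2 this holds when
    4u <= a+1 and a < b. The triples of the recurrence are D(u^2)-triples
    because X = 2n+1, Y = 2a_k+1, Z = 2a_(k+1)+1 satisfy the symmetric
    equation X^2 + Y^2 + Z^2 = 2XYZ + 64u^2 + 1, which gives
    64 (T_n T_(a_k) + u^2) = (XY - Z)^2 and its permutations. *)

Set Implicit Arguments.
Unset Strict Implicit.
Unset Printing Implicit Defensive.

Local Open Scope nat_scope.

Lemma double_triangular (m : nat) : 2 * triangular m = m * m.+1.
Proof.
by rewrite mulnC /triangular divnK // dvdn2 oddM /=; case: (odd m).
Qed.

Lemma sqr_double_triangular (m : nat) : (2 * m + 1) ^ 2 = 8 * triangular m + 1.
Proof. by have := double_triangular m; move: (triangular m) => t; lia. Qed.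

Lemma leq_triangular (m n : nat) : (triangular m <= triangular n) = (m <= n).
Proof.
have := double_triangular m; have := double_triangular n.
by move=> Tn Tm; apply/idP/idP => h; nia.
Qed.

Lemma ltn_triangular (m n : nat) : (triangular m < triangular n) = (m < n).
Proof. by rewrite !ltnNge leq_triangular. Qed.

Lemma regular_triangular_bound (N a b c : nat) :
  0 < N -> a < b -> b < c ->
  (((triangular c)%:Z - (triangular a)%:Z - (triangular b)%:Z) ^+ 2
     = 4%:Z * ((triangular a)%:Z * (triangular b)%:Z + N%:Z))%R ->
  a.+1 * b.+1 * (a + b).+1 <= 4 * N.
Proof.
move=> N0 ab bc reg; rewrite leqNgt; apply/negP => small.
have Ta := double_triangular a; have Tb := double_triangular b.
have Tc := double_triangular c.
have lt_bc : triangular b < triangular c by rewrite ltn_triangular.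
have le_ab : triangular a <= triangular b by rewrite leq_triangular ltnW.
move: reg; set W := (_ - _ - _)%R => reg.
have W2 : (W * W = (a * a.+1 * (b * b.+1) + 4 * N)%N%:Z)%R.
  by rewrite -GRing.expr2 reg -Ta -Tb; lia.
(* A negative W would satisfy |W| < T_a because T_b < T_c, hence W^2 < T_a^2 <= T_a T_b, against W^2
   = 4(T_a T_b + N). *)
have W0 : (0 <= W)%R.
  have : (- W < (triangular a)%:Z)%R by rewrite /W; lia.
  move: W reg le_ab {W2 Ta Tb Tc lt_bc small} => W.
  move: (triangular a) (triangular b) => p q reg le_pq ltWp.
  by rewrite Order.TotalTheory.leNgt; apply/negP => W0; nia.
have [w wE] : exists w : nat, W = w%:Z%R by exists `|W|%N; lia.
have w2 : w ^ 2 = a * a.+1 * (b * b.+1) + 4 * N.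
  by move: W2; rewrite wE -mulnn; lia.
have lo : a * b < w.
  by rewrite -ltn_sqr w2 {w2 small}; clear -N0; nia.
(* ((a+1)(b+1))^2 - a(a+1)b(b+1) = (a+1)(b+1)(a+b+1), so [small] is exactly this comparison of
   squares. *)
have hi : w < a.+1 * b.+1.
  by rewrite -ltn_sqr w2; clear -small; lia.
have Tab := double_triangular (a + b).
have Tab1 := double_triangular (a + b).+1.
have : triangular (a + b) < triangular c by rewrite /W in wE; lia.
have : triangular c < triangular (a + b).+1 by rewrite /W in wE; lia.
by rewrite !ltn_triangular; lia.
Qed.

Lemma irregular_smallest_triangular (u n : nat) (S : {fset nat}) :
  0 < u -> 4 * u <= n.+1 -> smallest_element (triangular n) S ->
  irregular (u ^ 2) S.
Proof.
move=> u0 un [nS minS] [a [b [c [_ ab bc SE reg]]]].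
(* Minimality turns the bound on n into a+1 >= 4u, so that (a+1)(b+1)(a+b+1) >= (4u)^3 > 4u^2. *)
have le_na : n <= a.
  by rewrite -leq_triangular; apply: minS; rewrite SE !inE eqxx.
have := regular_triangular_bound _ ab bc reg.
by rewrite expn_gt0 u0 => /(_ isT); nia.
Qed.

(** A Markov-type equation, stated on indices since 2x+1 is the square root of 8 T_x + 1. *)
Definition markov (u x y z : nat) : Prop :=
  (2 * x + 1) ^ 2 + (2 * y + 1) ^ 2 + (2 * z + 1) ^ 2 =
  2 * ((2 * x + 1) * (2 * y + 1) * (2 * z + 1)) + 64 * u ^ 2 + 1.

Lemma markov_rot (u x y z : nat) : markov u x y z -> markov u y z x.
Proof.
rewrite /markov; move: (2 * x + 1) (2 * y + 1) (2 * z + 1) => X Y Z.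
by move=> E; rewrite (mulnC (Y * Z)) (mulnA X) (addnC _ (X ^ 2)) addnA.
Qed.

Lemma markov_swap (u x y z : nat) : markov u x y z -> markov u y x z.
Proof.
rewrite /markov; move: (2 * x + 1) (2 * y + 1) (2 * z + 1) => X Y Z.
by rewrite (mulnC Y) (addnC (Y ^ 2)).
Qed.

(* Vieta jumping: for fixed n and y, 2x+1 and 2z+1 are the two roots of the
   relation, which is quadratic and monic in the remaining entry. *)
Lemma markov_vieta (u n x y z : nat) :
  markov u n x y -> z + x = 2 * (2 * n + 1) * y + 2 * n -> markov u n y z.
Proof.
rewrite /markov => E zx.
have : (2 * x + 1) + (2 * z + 1) = 2 * ((2 * n + 1) * (2 * y + 1)) by lia.
move: E; move: (2 * n + 1) (2 * x + 1) (2 * y + 1) (2 * z + 1) (64 * u ^ 2).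
move=> U X Y Z C {zx} E XZ.
have EX : X * (X + Z) = 2 * (U * X * Y) by rewrite XZ; lia.
have EZ : Z * (X + Z) = 2 * (U * Y * Z) by rewrite XZ; lia.
by clear XZ; lia.
Qed.

(** Completing the square in Z gives (XY - Z)^2 = (X^2 - 1)(Y^2 - 1) + 64u^2, where X^2 - 1 = 8 T_x
    and Y^2 - 1 = 8 T_y. As 8^2 divides this square, 8 divides XY - Z, and the quotient is the
    root. *)
Lemma perfect_square_markov (u x y z : nat) :
  markov u x y z -> perfect_square (triangular x * triangular y + u ^ 2).
Proof.
rewrite /markov; set P := (2 * x + 1) * (2 * y + 1); set Z := 2 * z + 1 => E.
(* XY - Z can have either sign, hence the distance. *)
pose m := `|P - Z|%N.
have mE : m ^ 2 = 8 ^ 2 * (triangular x * triangular y + u ^ 2).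
  have := sqrn_dist P Z; rewrite -/m.
  have : P ^ 2 = (8 * triangular x + 1) * (8 * triangular y + 1).
    by rewrite /P expnMn !sqr_double_triangular.
  move: E; rewrite !sqr_double_triangular.
  move: (triangular x) (triangular y) (m ^ 2) (P ^ 2) (Z ^ 2) (P * Z) (u ^ 2).
  by clear => p q m2 P2 Z2 PZ u2; lia.
have /dvdnP[r rE] : 8 %| m by rewrite -(@dvdn_pexp2r _ _ 2) // mE dvdn_mulr.
exists r; apply/eqP; rewrite -(@eqn_pmul2l (8 ^ 2)) // -mE rE expnMn.
by rewrite mulnC.
Qed.

Lemma ltn_aseq (u n k : nat) : 0 < n -> aseq u n k < aseq u n k.+1.
Proof.
move=> n0; case: k => [|k]; first by rewrite /=; lia.
by have := leq_aseq u n k; rewrite aseqSS; nia.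
Qed.

Lemma markov_aseq (u n k : nat) :
  0 < u -> n = 4 * u - 1 \/ n = 4 * u ->
  markov u n (aseq u n k) (aseq u n k.+1).
Proof.
move=> u0 nE; elim: k => [|k IHk].
  (* For the entries n, 0, n+4u the relation reduces to (Z - X)^2 = 64u^2, and here Z - X = 8u. *)
  by rewrite /markov /=; case: nE => ->; nia.
by apply: markov_vieta IHk _; have := aseq_rec u n k; lia.
Qed.

Theorem corollary3p2 (u : nat) (hu : 0 < u) :
  (forall S : {fset nat},
     D_triple (u ^ 2) S ->
     (forall x, x \in S -> is_triangular x) ->
     smallest_element (triangular (4 * u - 1)) S
       \/ smallest_element (triangular (4 * u)) S ->
     irregular (u ^ 2) S)
  /\
  (forall n : nat, n = 4 * u - 1 \/ n = 4 * u ->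
     forall k : nat, 1 <= k ->
       let S := [fset triangular n; triangular (aseq u n k);
                      triangular (aseq u n k.+1)]%fset in
       D_triple (u ^ 2) S /\ irregular (u ^ 2) S).
Proof.
split=> [S _ _ [] sm|n nE k k1]; last cbv zeta.
- by apply: irregular_smallest_triangular sm; lia.
- by apply: irregular_smallest_triangular sm; lia.
have n0 : 0 < n by lia.
(* This is where k >= 1 matters: a_0 = 0, but a_1 = n+4u exceeds n and the sequence increases. *)
have lt_nk : n < aseq u n k.
  elim: k k1 => // -[|k] IH _; first by rewrite /=; lia.
  by apply: ltn_trans (IH isT) (ltn_aseq _ _ n0).
have lt_kk : aseq u n k < aseq u n k.+1 by apply: ltn_aseq.
have mk := markov_aseq k hu nE.
move: (aseq u n k) (aseq u n k.+1) lt_nk lt_kk mk => b c nb bc mk.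
have Tnb : triangular n < triangular b by rewrite ltn_triangular.
have Tbc : triangular b < triangular c by rewrite ltn_triangular.
have Tn0 : 0 < triangular n by rewrite (ltn_triangular 0 n).
split; last first.
  apply: (@irregular_smallest_triangular u n) => //; first by lia.
  split=> [|y]; rewrite !inE ?eqxx //.
  by move=> /orP[/orP[]|] /eqP ->; lia.
have sq := perfect_square_markov.
split=> [|x|x y].
- by rewrite fsetUC cardfsU1 cardfs2 !inE; lia.
- by rewrite !inE => /orP[/orP[]|] /eqP ->; lia.
(* The three rotations put each pair of entries in the first two places; the swaps supply the
   reversed pairs. *)
have mk' := markov_rot mk; have mk'' := markov_rot mk'.
rewrite !inE => /orP[/orP[]|] /eqP -> /orP[/orP[]|] /eqP ->; rewrite ?eqxx // => _.
all: by [apply: sq mk|apply: sq mk'|apply: sq mk''|apply: sq (markov_swap mk)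
        |apply: sq (markov_swap mk')|apply: sq (markov_swap mk'')].
Qed.
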